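(* The $\odot$-action of $\hat{\mathcal Q}_{W_a}$ on $\hat{\mathcal Q}_{W_a}^*$ induces an action of $\hat{\mathbf D}_{W_a}$ on $\hat{\mathbf D}_{W_a}^*$; that is, $z\odot f\in\hat{\mathbf D}_{W_a}^*$ for all $z\in\hat{\mathbf D}_{W_a}$ and $f\in\hat{\mathbf D}_{W_a}^*$.
   Context: Root data: $G$ is a simple, simply connected algebraic group over $\mathbb{C}$ with maximal torus $T$, character group $T^*$, Weyl group $W$, finite root system $\Phi$, simple roots $\alpha_1,\dots,\alpha_n$, highest root $\theta$, coroot lattice $Q^\vee$. Set $T_a^*=T^*\oplus\mathbb{Z}\delta$, $\alpha_0=-\theta+\delta$, $\Phi_a=\{\alpha+k\delta\mid\alpha\in\Phi,k\in\mathbb{Z}\}$. The affine Weyl group $W_a=W\ltimes Q^\vee$ (elements $t_\lambda w$) acts on $T_a^*$ with reflections $s_{\alpha+k\delta}=s_\alpha t_{k\alpha^\vee}$ acting by $s_{\alpha+k\delta}(\mu+m\delta)=\mu+m\delta-\langle\mu,\alpha^\vee\rangle(\alpha+k\delta)$. $W_a$ is a Coxeter group with simple reflections $s_i=s_{\alpha_i}$, $0\le i\le n$. Algebra: $R$ is an integral domain of characteristic $0$, $F$ a one-dimensional (commutative) formal group law over $R$, $\hat S=R[[x_\mu\mid\mu\in T_a^*]]/\mathcal{J}_F$, where $\mathcal{J}_F$ is the closure of the ideal generated by $x_0$ and all $x_{\mu_1+\mu_2}-F(x_{\mu_1},x_{\mu_2})$ (convention: if $F(x,y)=x+y-\mathfrak{c}xy$,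 the polynomial version $R[x_\mu\mid\mu\in T_a^*]/\mathcal J_F$ is used instead). $W_a$ acts by $w(x_\mu)=x_{w(\mu)}$. $\hat{\mathcal Q}=\hat S[\frac1{x_\alpha}\mid\alpha\in\Phi_a]$. $\hat{\mathcal Q}_{W_a}=\hat{\mathcal Q}\rtimes R[W_a]$ is the free left $\hat{\mathcal Q}$-module on $\eta_w$, $w\in W_a$, with product $c\eta_wc'\eta_{w'}=c\,w(c')\eta_{ww'}$. Put $\hat X_i=\frac1{x_{\alpha_i}}(1-\eta_{s_i})$, $0\le i\le n$. $\hat{\mathbf D}_{W_a}$ is the subalgebra of $\hat{\mathcal Q}_{W_a}$ generated by $\hat S$ and $\hat X_0,\dots,\hat X_n$; for any choice of reduced words $I_w$ of $w\in W_a$, the products $\hat X_{I_w}$ form an $\hat S$-basis of $\hat{\mathbf D}_{W_a}$ and a $\hat{\mathcal Q}$-basis of $\hat{\mathcal Q}_{W_a}$. Duals: $\hat{\mathcal Q}_{W_a}^*=\mathrm{Hom}_{\hat{\mathcal Q}}(\hat{\mathcal Q}_{W_a},\hat{\mathcal Q})$ (left-linear maps), $\hat{\mathbf D}_{W_a}^*=\mathrm{Hom}_{\hat S}(\hat{\mathbf D}_{W_a},\hat S)$, viewed inside $\hat{\mathcal Q}_{W_a}^*$ by $\hat{\mathcal Q}$-linear extension. The left Hecke action $\odot$ of $\hat{\mathcal Q}_{W_a}$ on $\hat{\mathcal Q}_{W_a}^*$ is given by $(a\eta_v\odot f)(\eta_w)=a\,v\big(f(\eta_{v^{-1}w})\big)$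 for $a\in\hat{\mathcal Q}$, $v,w\in W_a$ (extended additively in $a\eta_v$). *)

(* Defs.v *)
From HB Require Import structures.
From mathcomp Require Import all_boot all_order all_algebra.
From mathcomp Require Import generic_quotient ring_quotient ring.
From mathcomp Require Import finmap monalg boolp.

Set Implicit Arguments.
Unset Strict Implicit.
Unset Printing Implicit Defensive.

Import GRing.Theory.
Local Open Scope ring_scope.
Local Open Scope quotient_scope.

Section Homogeneous.
Variables (R : comNzRingType) (I : choiceType).
Local Notation P := {malg R[{cmonom I}]}.

Definition homog (d : nat) (p : P) := all (fun m => mdeg m == d) (msupp p).

Lemma homogP d p :
  reflect (forall m, m \in msupp p -> mdeg m = d) (homog d p).
Proof. by apply: (iffP allP) => h m /h /eqP. Qed.

Lemma homog0 d : homog d 0. Proof. by rewrite /homog msupp0. Qed.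

Lemma homogN d p : homog d p -> homog d (- p).
Proof. by rewrite /homog msuppN. Qed.

Lemma homogD d p q : homog d p -> homog d q -> homog d (p + q).
Proof.
move=> /homogP hp /homogP hq; apply/homogP => m.
by move=> /(fsubsetP (msuppD_le _ _)); rewrite in_fsetU => /orP[/hp|/hq].
Qed.

Lemma homog_sum d (J : Type) (r : seq J) (Q : pred J) (f : J -> P) :
  (forall i, Q i -> homog d (f i)) -> homog d (\sum_(i <- r | Q i) f i).
Proof. by move=> h; elim/big_ind: _ => //; [apply: homog0|apply: homogD]. Qed.

Lemma homogZ d c p : homog d p -> homog d (c *: p).
Proof.
move=> /homogP hp; apply/homogP => m.
by move=> /(fsubsetP (msuppZ_le _ _)) /hp.
Qed.

Lemma homogM d e p q : homog d p -> homog e q -> homog (d + e) (p * q).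
Proof.
move=> /homogP hp /homogP hq; apply/homogP => m.
by move=> /msuppM_le [k1 [k2 [/hp <- /hq <- ->]]]; rewrite mdegM.
Qed.

Lemma homog1 : homog 0 1.
Proof.
apply/homogP => m; rewrite -mpolyC1E => /(fsubsetP (msuppC_le _)).
by rewrite in_fset1 => /eqP ->; rewrite mdeg1.
Qed.

Lemma homogU i : homog 1 << ucm i >>.
Proof. by apply/homogP => m; rewrite msuppU1 in_fset1 => /eqP ->; rewrite mdegU. Qed.

End Homogeneous.

(* For infinite I, R[[x_i | i in I]] is the completion of R[x_i | i in I] at the
   kernel of the augmentation x_i |-> 0.  As an additive group it is the product
   of the homogeneous components of R[x_i | i in I], which is how it is encoded:
   an element is the sequence of its homogeneous components.  The topology is
   given by the ideals of series whose components of degree < N vanish. *)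
Section FpsDef.
Variables (R : comNzRingType) (I : choiceType).
Local Notation P := {malg R[{cmonom I}]}.

Record fps := Fps { hcomp :> nat -> P; hcompP : forall d, homog d (hcomp d) }.

HB.instance Definition _ := gen_eqMixin fps.
HB.instance Definition _ := gen_choiceMixin fps.

Lemma fps_eqP (p q : fps) : hcomp p =1 hcomp q -> p = q.
Proof.
case: p q => [p hp] [q hq] /= /funext epq; case: _ / epq hq => hq.
by congr Fps; apply: Prop_irrelevance.
Qed.

Definition fps0 := @Fps (fun=> 0) (fun d => homog0 R I d).
Definition fpsN (p : fps) := @Fps (fun d => - p d) (fun d => homogN (hcompP p d)).
Definition fpsD (p q : fps) :=
  @Fps (fun d => p d + q d) (fun d => homogD (hcompP p d) (hcompP q d)).

Fact fps1_subproof d : homog d (if d == 0%N then 1 else 0 : P).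
Proof. by case: eqP => [->|_]; [apply: homog1|apply: homog0]. Qed.
Definition fps1 := Fps fps1_subproof.

Fact fpsM_subproof (p q : fps) d :
  homog d (\sum_(i < d.+1) p i * q (d - i)%N).
Proof.
apply: homog_sum => i _; rewrite -[X in homog X _](subnKC (ltn_ord i : i <= d)%N).
exact: homogM (hcompP _ _) (hcompP _ _).
Qed.
Definition fpsM p q := Fps (fpsM_subproof p q).

Fact fpsDA : associative fpsD.
Proof. by move=> p q r; apply: fps_eqP => d /=; rewrite addrA. Qed.
Fact fpsDC : commutative fpsD.
Proof. by move=> p q; apply: fps_eqP => d /=; rewrite addrC. Qed.
Fact fps0D : left_id fps0 fpsD.
Proof. by move=> p; apply: fps_eqP => d /=; rewrite add0r. Qed.
Fact fpsND : left_inverse fps0 fpsN fpsD.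
Proof. by move=> p; apply: fps_eqP => d /=; rewrite addNr. Qed.
HB.instance Definition _ := GRing.isZmodule.Build fps fpsDA fpsDC fps0D fpsND.

Let trunc N (p : fps) : {poly P} := \poly_(i < N) p i.

Let truncM N p q d : (d < N)%N -> (trunc N p * trunc N q)`_d = fpsM p q d.
Proof.
move=> ltdN; rewrite coefM; apply: eq_bigr => i _; rewrite !coef_poly.
have led : (i <= d)%N by rewrite -ltnS.
by rewrite (leq_ltn_trans led ltdN) (leq_ltn_trans (leq_subr i d) ltdN).
Qed.

Let coefM_eq (p q p' q' : {poly P}) d :
  (forall i, (i <= d)%N -> p`_i = p'`_i) -> (forall i, (i <= d)%N -> q`_i = q'`_i) ->
  (p * q)`_d = (p' * q')`_d.
Proof.
move=> ep eq; rewrite !coefM; apply: eq_bigr => i _.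
by rewrite ep ?eq ?leq_subr // -ltnS.
Qed.

Let truncE N p d : (d < N)%N -> (trunc N p)`_d = p d.
Proof. by move=> h; rewrite coef_poly h. Qed.

Fact fpsMC : commutative fpsM.
Proof.
by move=> p q; apply: fps_eqP => d; rewrite -!(@truncM d.+1) // mulrC.
Qed.
Fact fpsMA : associative fpsM.
Proof.
move=> p q r; apply: fps_eqP => d; rewrite -!(@truncM d.+1) //.
transitivity ((trunc d.+1 p * (trunc d.+1 q * trunc d.+1 r))`_d).
  by apply: coefM_eq => // i lid; rewrite truncM // truncE.
rewrite mulrA; apply: coefM_eq => // i lid; by rewrite truncM // truncE.
Qed.
Fact fps1M : left_id fps1 fpsM.
Proof.
move=> p; apply: fps_eqP => d /=; rewrite big_ord_recl /= mul1r subn0.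
by rewrite big1 ?addr0 // => i _; rewrite mul0r.
Qed.
Fact fpsMDl : left_distributive fpsM fpsD.
Proof.
move=> p q r; apply: fps_eqP => d /=; rewrite -big_split /=.
by apply: eq_bigr => i _; rewrite mulrDl.
Qed.
Fact fps1_neq0 : fps1 != fps0.
Proof. by apply/eqP => /(congr1 (fun p : fps => p 0%N)) /= /eqP; rewrite oner_eq0. Qed.
HB.instance Definition _ :=
  GRing.Zmodule_isComNzRing.Build fps fpsMA fpsMC fps1M fpsMDl fps1_neq0.

Fact fpsX_subproof i d : homog d (if d == 1%N then << ucm i >> else 0 : P).
Proof. by case: eqP => [->|_]; [apply: homogU|apply: homog0]. Qed.
Definition fpsX i := Fps (fpsX_subproof i).

End FpsDef.

Section FpsEval.
Variables (R : comNzRingType) (I : choiceType).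
Local Notation P := {malg R[{cmonom I}]}.
Local Notation fps := (fps R I).

Lemma fps_sumE (J : Type) (r : seq J) (Q : pred J) (f : J -> fps) d :
  (\sum_(i <- r | Q i) f i) d = \sum_(i <- r | Q i) f i d.
Proof. by apply: (big_morph (fun p : fps => p d)). Qed.

Lemma fpsME (p q : fps) d : (p * q) d = \sum_(i < d.+1) p i * q (d - i)%N.
Proof. by []. Qed.

Lemma fps_lin_below N (a p q p' q' : fps) :
  (forall d, (d < N)%N -> p d = p' d) -> (forall d, (d < N)%N -> q d = q' d) ->
  forall d, (d < N)%N -> (a * p + q) d = (a * p' + q') d.
Proof.
move=> ep eq d ltd.
have -> : (a * p + q) d = (a * p) d + q d by [].
have -> : (a * p' + q') d = (a * p') d + q' d by [].
have h (i : 'I_d.+1) : p (d - i)%N = p' (d - i)%N.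
  exact: ep _ (leq_ltn_trans (leq_subr i d) ltd).
have {}h : (a * p) d = (a * p') d.
  by rewrite (fpsME a p) (fpsME a p'); apply: eq_bigr => i _; rewrite (h i).
by rewrite h (eq _ ltd).
Qed.

(* p belongs to the polynomial ring R[x_i | i in I] *)
Definition fps_pol (p : fps) : Prop := exists N, forall d, (N <= d)%N -> p d = 0.

(* fps_eval2 a p q is the sum of the a_ij p^i q^j.  Truncating at i, j <= d in
   degree d is correct only if p and q have no constant term; all uses below
   satisfy this condition. *)
Fact fps_eval2_subproof (a : nat -> nat -> R) (p q : fps) d :
  homog d (\sum_(i < d.+1) \sum_(j < d.+1) a i j *: (p ^+ i * q ^+ j) d).
Proof.
by apply: homog_sum => i _; apply: homog_sum => j _; apply: homogZ; apply: hcompP.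
Qed.
Definition fps_eval2 a p q := Fps (fps_eval2_subproof a p q).

Definition monom_ren (g : I -> I) (m : {cmonom I}) : P :=
  \prod_(i <- finsupp m) << ucm (g i) >> ^+ m i.
Definition pol_ren (g : I -> I) : P -> P := mmap (@malgC {cmonom I} R) (monom_ren g).

Fact fps_ren_subproof (g : I -> I) (p : fps) d : homog d (pol_ren g (p d)).
Proof.
rewrite /pol_ren mmapE big_seq; apply: homog_sum => m m_p.
rewrite mul_malgC; apply: homogZ.
rewrite -(homogP _ _ (hcompP p d) _ m_p) mdegE /monom_ren.
elim/big_ind2: _ => [|e p1 e' p2|i _]; [exact: homog1|exact: homogM|].
elim: (m i) => [|k IHk]; first exact: homog1.
by rewrite exprS -[k.+1]add1n; apply: homogM IHk; apply: homogU.
Qed.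
Definition fps_ren g p := Fps (fps_ren_subproof g p).

End FpsEval.

(* F(x, y) is the sum of the a_ij x^i y^j; the axioms are F(x, 0) = x,
   F(0, y) = y, F(x, y) = F(y, x) and F(F(x, y), z) = F(x, F(y, z)), the last one
   in R[[x, y, z]]. *)
Record fgl (R : comNzRingType) := Fgl {
  fgl_coef :> nat -> nat -> R;
  _ : forall i, fgl_coef i 0%N = (i == 1%N)%:R;
  _ : forall j, fgl_coef 0%N j = (j == 1%N)%:R;
  _ : forall i j, fgl_coef i j = fgl_coef j i;
  _ : let X i : fps R 'I_3 := fpsX R (inord i) in
      let F := fps_eval2 fgl_coef in
      F (F (X 0%N) (X 1%N)) (X 2%N) = F (X 0%N) (F (X 1%N) (X 2%N)) }.

(* F(x, y) = x + y - c x y *)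
Definition fgl_polynomial (R : comNzRingType) (F : fgl R) : Prop :=
  exists c : R, forall i j,
    F i j = ((i, j) == (1, 0)%N)%:R + ((i, j) == (0, 1)%N)%:R
            - c * ((i, j) == (1, 1)%N)%:R.

Section FormalGroupAlgebra.
Variables (R : comNzRingType) (F : fgl R) (M : zmodType).
Local Notation fps := (fps R M).

(* The ambient ring is R[x_mu | mu in M] if F(x, y) = x + y - c x y, and
   R[[x_mu | mu in M]] otherwise. *)
Definition fga_pred (p : fps) : bool := `[< fgl_polynomial F -> fps_pol p >].

Fact fga_pred_subring : subring_closed fga_pred.
Proof.
split.
- apply/asboolP => _; exists 1%N => -[|d] //.
- move=> p q /asboolP hp /asboolP hq; apply/asboolP => pF.
  have [[N hN] [N' hN']] := (hp pF, hq pF).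
  exists (maxn N N') => d; rewrite geq_max => /andP[/hN p0 /hN' q0].
  by rewrite /= p0 q0 subrr.
- move=> p q /asboolP hp /asboolP hq; apply/asboolP => pF.
  have [[N hN] [N' hN']] := (hp pF, hq pF).
  exists (N + N')%N => d led; rewrite fpsME big1 // => i _.
  have [/hN ->|ltiN] := leqP N i; first by rewrite mul0r.
  rewrite hN' ?mulr0 // leq_subRL; last by rewrite -ltnS.
  by apply: leq_trans led; rewrite leq_add2r ltnW.
Qed.
HB.instance Definition _ := GRing.isSubringClosed.Build fps fga_pred fga_pred_subring.

Record fga_amb := FgaAmb { fga_val :> fps; _ : fga_pred fga_val }.
HB.instance Definition _ := [isSub for fga_val].
HB.instance Definition _ := [Choice of fga_amb by <:].
HB.instance Definition _ := [SubChoice_isSubComNzRing of fga_amb by <:].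

Definition fga_rel (p : fps) : Prop :=
  p = fpsX R 0 \/
  exists mu1 mu2 : M, p = fpsX R (mu1 + mu2) - fps_eval2 F (fpsX R mu1) (fpsX R mu2).

Definition fga_span (p : fga_amb) : Prop :=
  exists l : seq (fga_amb * fga_amb),
    (forall x, x \in l -> fga_rel (val x.2)) /\ p = \sum_(x <- l) x.1 * x.2.

(* The ideal J_F: the closure of the ideal generated by fga_rel, or this ideal
   itself in the polynomial version. *)
Definition fga_ideal_prop (p : fga_amb) : Prop :=
  if `[< fgl_polynomial F >] then fga_span p
  else forall N : nat, exists2 q, fga_span q & forall d, (d < N)%N -> val p d = val q d.

Definition fga_ideal (p : fga_amb) : bool := `[< fga_ideal_prop p >].

Lemma fga_span0 : fga_span 0.
Proof. by exists [::]; rewrite big_nil. Qed.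
Lemma fga_spanD p q : fga_span p -> fga_span q -> fga_span (p + q).
Proof.
move=> [l [hl ->]] [l' [hl' ->]]; exists (l ++ l'); rewrite big_cat; split=> //.
by move=> x; rewrite mem_cat => /orP[/hl|/hl'].
Qed.
Lemma fga_spanM a p : fga_span p -> fga_span (a * p).
Proof.
move=> [l [hl ->]]; exists [seq (a * x.1, x.2) | x <- l]; split.
  by move=> _ /mapP[x /hl ? ->].
by rewrite big_map mulr_sumr; apply: eq_bigr => x _; rewrite mulrA.
Qed.

Lemma fga_rel_aug (p : fps) : fga_rel p -> p 0%N = 0.
Proof.
case=> [-> //|[mu1 [mu2 ->]]] /=; rewrite !big_ord1 !expr0 sub0r.
by case: F => a /= h1 _ _ _; rewrite h1 scale0r oppr0.
Qed.

Lemma fga_span_aug p : fga_span p -> val p 0%N = 0.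
Proof.
move=> [l [hl ->]]; rewrite (raddf_sum val) fps_sumE big_seq big1 //= => x /hl /fga_rel_aug h.
by rewrite big_ord1 /= h mulr0.
Qed.

Fact fga_ideal_closed : idealr_closed fga_ideal.
Proof.
rewrite /idealr_closed /in_mem /=; split.
- apply/asboolP; rewrite /fga_ideal_prop; case: ifP => _; first exact: fga_span0.
  by move=> N; exists 0 => //; exact: fga_span0.
- apply/negP => /asboolP; rewrite /fga_ideal_prop; case: ifP => _.
    by move=> /fga_span_aug /= /eqP; rewrite oner_eq0.
  by case/(_ 1%N) => q /fga_span_aug q0 /(_ 0%N isT); rewrite q0 /= => /eqP; rewrite oner_eq0.
- move=> a p q /asboolP hp /asboolP hq; apply/asboolP; move: hp hq.
  rewrite /fga_ideal_prop; case: ifP => _ hp hq.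
    by apply: fga_spanD hq; apply: fga_spanM.
  move=> N; have [[p' sp ep] [q' sq eq]] := (hp N, hq N).
  exists (a * p' + q'); first by apply: fga_spanD sq; apply: fga_spanM.
  move=> d ltd; exact: (@fps_lin_below _ _ N (val a) _ _ _ _ ep eq d ltd).
Qed.
HB.instance Definition _ := isIdealr.Build fga_amb fga_ideal fga_ideal_closed.

Definition fga_idealr : idealr fga_amb := fga_ideal.
Definition fga : comNzRingType := {ideal_quot fga_idealr}.

End FormalGroupAlgebra.

Section Renaming.
Variables (R : comNzRingType) (I : choiceType) (g : I -> I).
Local Notation P := {malg R[{cmonom I}]}.
Local Notation fps := (fps R I).
Local Notation ren := (@fps_ren R I g).

Fact monom_ren_mmorphism : mmorphism (@monom_ren R I g).
Proof.
have renE (D : {fset I}) (m : {cmonom I}) : (finsupp m `<=` D)%fset ->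
    monom_ren R g m = \prod_(i <- D) << ucm (g i) >> ^+ m i.
  move=> sub; rewrite /monom_ren.
  apply: (big_fset_incl _ sub) => i _; rewrite -cmE_eq0 => /eqP ->.
  by rewrite expr0.
split=> [m1 m2|]; last by rewrite /monom_ren mdom1 big_seq_fset0.
rewrite /monom_ren mdomD; rewrite -!/(monom_ren R g _).
rewrite (renE _ _ (fsubsetUl (finsupp m1) (finsupp m2))).
rewrite (renE _ _ (fsubsetUr (finsupp m1) (finsupp m2))) -big_split /=.
by apply: eq_bigr => i _; rewrite cmM exprD.
Qed.
HB.instance Definition _ :=
  isMultiplicative.Build {cmonom I} P (@monom_ren R I g) monom_ren_mmorphism.

HB.instance Definition _ := GRing.RMorphism.copy (@pol_ren R I g)
  (mmap (@malgC {cmonom I} R) (monom_ren R g)).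

Lemma pol_renZ (c : R) (p : P) : pol_ren g (c *: p) = c *: pol_ren g p.
Proof. by rewrite /pol_ren mmapZ mul_malgC. Qed.

Lemma fps_renE p d : ren p d = pol_ren g (p d). Proof. by []. Qed.

Fact fps_ren_zmod : zmod_morphism ren.
Proof.
move=> p q; apply: fps_eqP => d.
have E (r s : fps) : (r - s) d = r d - s d by [].
by rewrite (E _ _) !fps_renE (E p q) rmorphB.
Qed.
HB.instance Definition _ := GRing.isZmodMorphism.Build fps fps ren fps_ren_zmod.

Fact fps_ren_monoid : monoid_morphism ren.
Proof.
split=> [|p q]; apply: fps_eqP => d.
  by rewrite fps_renE /=; case: eqP => _; rewrite ?rmorph1 ?rmorph0.
rewrite fps_renE (fpsME p q) (fpsME (ren p) (ren q)) rmorph_sum.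
by apply: eq_bigr => i _; rewrite rmorphM.
Qed.
HB.instance Definition _ := GRing.isMonoidMorphism.Build fps fps ren fps_ren_monoid.

Lemma fps_renX i : ren (fpsX R i) = fpsX R (g i).
Proof.
apply: fps_eqP => d; rewrite fps_renE /=; case: eqP => _; last exact: rmorph0.
rewrite /pol_ren mmapU mul1r /monom_ren mdomU big_seq_fset1 cmUU.
by rewrite expr1.
Qed.

Lemma fps_eval2E a (p q : fps) d : fps_eval2 a p q d =
  \sum_(i < d.+1) \sum_(j < d.+1) a i j *: (p ^+ i * q ^+ j) d.
Proof. by []. Qed.

Lemma fps_ren_eval2 a p q :
  ren (fps_eval2 a p q) = fps_eval2 a (ren p) (ren q).
Proof.
apply: fps_eqP => d; rewrite fps_renE (fps_eval2E a p q) (fps_eval2E a (ren p)).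
rewrite rmorph_sum; apply: eq_bigr => i _.
rewrite rmorph_sum; apply: eq_bigr => j _; rewrite [LHS]pol_renZ.
have -> // : ren p ^+ i * ren q ^+ j = ren (p ^+ i * q ^+ j).
by rewrite rmorphM !rmorphXn.
Qed.
End Renaming.

Section FgaAction.
Variables (R : comNzRingType) (F : fgl R) (M : zmodType).
Local Notation fps := (fps R M).
Local Notation amb := (fga_amb F M).
Local Notation S := (fga F M).

Definition fga_pi (p : amb) : S := \pi_({ideal_quot (fga_idealr F M)}) p.
HB.instance Definition _ := GRing.RMorphism.copy fga_pi
  (\pi_({ideal_quot (fga_idealr F M)})).

Fact fga_x_subproof (mu : M) : fga_pred F (fpsX R mu).
Proof. by apply/asboolP => _; exists 2%N => -[|[|d]]. Qed.
Definition fga_x (mu : M) : S := fga_pi (FgaAmb (fga_x_subproof mu)).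

Lemma fga_piP (a : S) : exists p, a = fga_pi p.
Proof. by exists (repr (a : {ideal_quot (fga_idealr F M)})); rewrite /fga_pi reprK. Qed.

Lemma fga_pi_eq p q : fga_pi p = fga_pi q <-> fga_ideal_prop (p - q).
Proof.
split=> [/eqP|h]; last apply/eqP.
  by rewrite /fga_pi -Quotient.idealrBE => /asboolP.
by rewrite /fga_pi -Quotient.idealrBE; apply/asboolP.
Qed.

Variable g : {additive M -> M}.

Fact amb_ren_subproof (p : amb) : fga_pred F (fps_ren g (val p)).
Proof.
case: p => p /= /asboolP hp; apply/asboolP => /hp[N hN]; exists N => d /hN pd0.
by rewrite fps_renE pd0 rmorph0.
Qed.
Definition amb_ren (p : amb) : amb := FgaAmb (amb_ren_subproof p).

Fact amb_ren_zmod : zmod_morphism amb_ren.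
Proof. by move=> p q; apply: val_inj; rewrite /= rmorphB. Qed.
HB.instance Definition _ := GRing.isZmodMorphism.Build amb amb amb_ren amb_ren_zmod.
Fact amb_ren_monoid : monoid_morphism amb_ren.
Proof. by split=> [|p q]; apply: val_inj; rewrite /= ?rmorph1 ?rmorphM. Qed.
HB.instance Definition _ := GRing.isMonoidMorphism.Build amb amb amb_ren amb_ren_monoid.

Lemma fga_rel_ren (p : fps) : fga_rel F p -> fga_rel F (fps_ren g p).
Proof.
case=> [->|[mu1 [mu2 ->]]]; first by left; rewrite fps_renX raddf0.
right; exists (g mu1), (g mu2).
by rewrite fps_ren_zmod fps_ren_eval2 !fps_renX raddfD.
Qed.

Lemma fga_span_ren p : fga_span p -> fga_span (amb_ren p).
Proof.
move=> [l [hl ->]]; exists [seq (amb_ren x.1, amb_ren x.2) | x <- l]; split.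
  by move=> _ /mapP[x /hl hx ->]; apply: fga_rel_ren.
by rewrite big_map rmorph_sum; apply: eq_bigr => x _; rewrite rmorphM.
Qed.

Lemma fga_ideal_ren p : fga_ideal_prop p -> fga_ideal_prop (amb_ren p).
Proof.
rewrite /fga_ideal_prop; case: ifP => _; first exact: fga_span_ren.
move=> h N; have [q sq eq] := h N; exists (amb_ren q); first exact: fga_span_ren.
by move=> d ltd; rewrite [LHS]fps_renE [RHS]fps_renE (eq d ltd).
Qed.

(* The map induced by x_mu |-> x_(g mu); fga_map_pi shows that it does not depend
   on the representative. *)
Definition fga_map (a : S) : S :=
  fga_pi (amb_ren (repr (a : {ideal_quot (fga_idealr F M)}))).

Lemma fga_map_pi p : fga_map (fga_pi p) = fga_pi (amb_ren p).
Proof.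
apply/fga_pi_eq; rewrite -rmorphB; apply: fga_ideal_ren; apply/fga_pi_eq.
by rewrite /fga_pi reprK.
Qed.

Lemma fga_mapX mu : fga_map (fga_x mu) = fga_x (g mu).
Proof.
by rewrite fga_map_pi; congr fga_pi; apply: val_inj; rewrite /= fps_renX.
Qed.

Fact fga_map_zmod : zmod_morphism fga_map.
Proof.
move=> a b; have [[p ->] [q ->]] := conj (fga_piP a) (fga_piP b).
by rewrite -rmorphB !fga_map_pi -rmorphB -rmorphB.
Qed.
HB.instance Definition _ := GRing.isZmodMorphism.Build S S fga_map fga_map_zmod.
Fact fga_map_monoid : monoid_morphism fga_map.
Proof.
split=> [|a b]; first by rewrite -(rmorph1 fga_pi) fga_map_pi !rmorph1.
have [[p ->] [q ->]] := conj (fga_piP a) (fga_piP b).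
by rewrite -rmorphM !fga_map_pi -rmorphM -rmorphM.
Qed.
HB.instance Definition _ := GRing.isMonoidMorphism.Build S S fga_map fga_map_monoid.

End FgaAction.

(* S[1/x_j | j in J]: the pair (s, l) stands for s divided by the product of the
   x_j for j in l.  S is not assumed to be a domain, and the localization is only
   known to be a possibly trivial ring (comPzRingType) at this stage. *)
Section Localization.
Variables (S : comNzRingType) (J : choiceType) (x : J -> S).

Definition den (l : seq J) : S := \prod_(j <- l) x j.

Lemma den_cat l k : den (l ++ k) = den l * den k.
Proof. by rewrite /den big_cat. Qed.

Definition frac_equiv (p q : S * seq J) : bool :=
  `[< exists l, den l * (p.1 * den q.2 - q.1 * den p.2) = 0 >].

Fact frac_equiv_subproof : equiv_class_of frac_equiv.
Proof.
split=> [p|p q|q p r].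
- by apply/asboolP; exists [::]; rewrite subrr mulr0.
- by apply/asbool_equiv_eq; split=> -[l h]; exists l; rewrite -opprB mulrN h oppr0.
- move=> /asboolP[l hl] /asboolP[k hk]; apply/asboolP; exists (l ++ k ++ q.2).
  rewrite !den_cat; transitivity (den k * den r.2 * (den l * (p.1 * den q.2 - q.1 * den p.2))
     + den l * den p.2 * (den k * (q.1 * den r.2 - r.1 * den q.2))); first by ring.
  by rewrite hl hk !mulr0 addr0.
Qed.
Canonical frac_equiv_rel := EquivRelPack frac_equiv_subproof.
Canonical frac_equiv_encModRel := defaultEncModRel frac_equiv.

Definition loc := {eq_quot frac_equiv}.
HB.instance Definition _ := Choice.on loc.

Definition frac (s : S) (l : seq J) : loc := \pi_loc (s, l).

Lemma fracP (a : loc) : exists s l, a = frac s l.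
Proof. by case E: (repr a) => [s l]; exists s, l; rewrite /frac -E reprK. Qed.

Lemma frac_eq s l t k :
  frac s l = frac t k <-> exists m, den m * (s * den k - t * den l) = 0.
Proof.
by split=> [/eqmodP/asboolP|h]; [|apply/eqmodP/asboolP].
Qed.

Lemma frac_repr (a : loc) : frac (repr a).1 (repr a).2 = a.
Proof. by rewrite /frac -surjective_pairing reprK. Qed.

Definition loc_opp (a : loc) := let: (s, l) := repr a in frac (- s) l.
Definition loc_add (a b : loc) :=
  let: (s, l) := repr a in let: (t, k) := repr b in
  frac (s * den k + t * den l) (l ++ k).
Definition loc_mul (a b : loc) :=
  let: (s, l) := repr a in let: (t, k) := repr b in frac (s * t) (l ++ k).

Lemma loc_oppE s l : loc_opp (frac s l) = frac (- s) l.
Proof.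
rewrite /loc_opp; have := frac_repr (frac s l); case: (repr _) => t k /=.
move/frac_eq => [m hm]; apply/frac_eq; exists m.
by rewrite !mulNr -opprD mulrN hm oppr0.
Qed.

Lemma loc_addE s l t k :
  loc_add (frac s l) (frac t k) = frac (s * den k + t * den l) (l ++ k).
Proof.
rewrite /loc_add; have := frac_repr (frac s l); have := frac_repr (frac t k).
case: (repr _) => t' k' /= /frac_eq[m hm].
case: (repr _) => s' l' /= /frac_eq[m' hm'].
apply/frac_eq; exists (m ++ m'); rewrite !den_cat.
transitivity (den m * den k * den k' * (den m' * (s' * den l - s * den l'))
  + den m' * den l * den l' * (den m * (t' * den k - t * den k'))); first by ring.
by rewrite hm hm' !mulr0 addr0.
Qed.

Lemma loc_mulE s l t k : loc_mul (frac s l) (frac t k) = frac (s * t) (l ++ k).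
Proof.
rewrite /loc_mul; have := frac_repr (frac s l); have := frac_repr (frac t k).
case: (repr _) => t' k' /= /frac_eq[m hm].
case: (repr _) => s' l' /= /frac_eq[m' hm'].
apply/frac_eq; exists (m ++ m'); rewrite !den_cat.
transitivity (den m * t' * den k * (den m' * (s' * den l - s * den l'))
  + den m' * s * den l' * (den m * (t' * den k - t * den k'))); first by ring.
by rewrite hm hm' !mulr0 addr0.
Qed.

Let frac_eq0 s l t k : s * den k = t * den l -> frac s l = frac t k.
Proof. by move=> e; apply/frac_eq; exists [::]; rewrite e subrr mulr0. Qed.

Fact loc_addA : associative loc_add.
Proof.
move=> a b c; have [[s [l ->]] [t [k ->]] [u [m ->]]] := And3 (fracP a) (fracP b) (fracP c).
by rewrite !loc_addE catA; apply: frac_eq0; rewrite !den_cat; ring.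
Qed.
Fact loc_addC : commutative loc_add.
Proof.
move=> a b; have [[s [l ->]] [t [k ->]]] := conj (fracP a) (fracP b).
by rewrite !loc_addE; apply: frac_eq0; rewrite !den_cat; ring.
Qed.
Fact loc_add0 : left_id (frac 0 [::]) loc_add.
Proof.
move=> a; have [s [l ->]] := fracP a.
by rewrite !loc_addE; apply: frac_eq0; rewrite /den !big_nil; ring.
Qed.
Fact loc_addN : left_inverse (frac 0 [::]) loc_opp loc_add.
Proof.
move=> a; have [s [l ->]] := fracP a.
by rewrite loc_oppE loc_addE; apply: frac_eq0; rewrite /den big_nil; ring.
Qed.
HB.instance Definition _ := GRing.isZmodule.Build loc loc_addA loc_addC loc_add0 loc_addN.

Fact loc_mulA : associative loc_mul.
Proof.
move=> a b c; have [[s [l ->]] [t [k ->]] [u [m ->]]] := And3 (fracP a) (fracP b) (fracP c).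
by rewrite !loc_mulE catA mulrA.
Qed.
Fact loc_mulC : commutative loc_mul.
Proof.
move=> a b; have [[s [l ->]] [t [k ->]]] := conj (fracP a) (fracP b).
by rewrite !loc_mulE; apply: frac_eq0; rewrite !den_cat; ring.
Qed.
Fact loc_mul1 : left_id (frac 1 [::]) loc_mul.
Proof. by move=> a; have [s [l ->]] := fracP a; rewrite !loc_mulE mul1r. Qed.
Fact loc_mulDl : left_distributive loc_mul loc_add.
Proof.
move=> a b c; have [[s [l ->]] [t [k ->]] [u [m ->]]] := And3 (fracP a) (fracP b) (fracP c).
by rewrite !(loc_mulE, loc_addE); apply: frac_eq0; rewrite !den_cat; ring.
Qed.
HB.instance Definition _ :=
  GRing.Zmodule_isComPzRing.Build loc loc_mulA loc_mulC loc_mul1 loc_mulDl.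

Definition loc_inj (s : S) : loc := frac s [::].
Definition loc_inv (j : J) : loc := frac 1 [:: j].

Lemma loc_invP j : loc_inj (x j) * loc_inv j = 1.
Proof.
by rewrite [LHS]loc_mulE; apply: frac_eq0; rewrite /den big_seq1 big_nil; ring.
Qed.

Variables (f : {rmorphism S -> S}) (g : J -> J).

(* Under the hypothesis fx below, this is the map induced by f (loc_map_frac). *)
Definition loc_map (a : loc) : loc := let: (s, l) := repr a in frac (f s) (map g l).

Hypothesis fx : forall j, f (x j) = x (g j).

Lemma loc_map_frac s l : loc_map (frac s l) = frac (f s) (map g l).
Proof.
have fden k : f (den k) = den (map g k).
  by rewrite /den rmorph_prod big_map; apply: eq_bigr => j _; rewrite fx.
rewrite /loc_map; have := frac_repr (frac s l); case: (repr _) => t k /=.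
move/frac_eq => [m /(congr1 f) hm]; apply/frac_eq; exists (map g m).
by move: hm; rewrite rmorph0 rmorphM rmorphB !rmorphM /= !fden.
Qed.

Fact loc_map_zmod : zmod_morphism loc_map.
Proof.
move=> a b; have [[s [l ->]] [t [k ->]]] := conj (fracP a) (fracP b).
have oppE u m : - frac u m = frac (- u) m by rewrite -loc_oppE.
have addE u m v n : frac u m + frac v n = frac (u * den n + v * den m) (m ++ n).
  by rewrite -loc_addE.
have fden m : f (den m) = den (map g m).
  by rewrite /den rmorph_prod big_map; apply: eq_bigr => j _; rewrite fx.
rewrite oppE addE !loc_map_frac oppE addE map_cat.
by rewrite rmorphD !rmorphM rmorphN /= !fden.
Qed.

Fact loc_map_monoid : monoid_morphism loc_map.
Proof.
split=> [|a b]; first by rewrite -[1]/(frac 1 [::]) loc_map_frac rmorph1.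
have [[s [l ->]] [t [k ->]]] := conj (fracP a) (fracP b).
have mulE u m v n : frac u m * frac v n = frac (u * v) (m ++ n) by rewrite -loc_mulE.
by rewrite mulE !loc_map_frac mulE map_cat rmorphM.
Qed.

End Localization.

(* Character and cocharacter lattices: after a choice of dual bases, T^* is the
   lattice of columns 'cV[int]_n and the cocharacter lattice is 'rV[int]_n. *)
Definition pairing (n : nat) (mu : 'cV[int]_n) (lam : 'rV[int]_n) : int :=
  (lam *m mu) 0 0.

(* The root datum of a simple simply connected group over the complex numbers with
   a maximal torus, a choice of simple roots and the highest root: a reduced
   irreducible root datum whose coroots generate the cocharacter lattice, i.e.,
   the coroot lattice Q^vee is the whole of 'rV[int]_n (coroot_span). *)
Record simple_sc_datum (n : nat) := SimpleScDatum {
  roots : {fset 'cV[int]_n};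
  coroot : roots -> 'rV[int]_n;
  simple_root : 'I_n -> roots;
  highest_root : roots;
  pairing_root : forall a, pairing (val a) (coroot a) = 2;
  refl_root : forall a b : roots,
    val b - pairing (val b) (coroot a) *: val a \in roots;
  coroot_inj : injective coroot;
  refl_coroot : forall a b, exists c,
    coroot c = coroot b - pairing (val a) (coroot b) *: coroot a;
  root_reduced : forall (a b : roots) (k l : int),
    k != 0 -> k *: val a = l *: val b -> val a = val b \/ val a = - val b;
  root_irreducible : forall P : pred roots,
    (forall a b, P a -> ~~ P b -> pairing (val a) (coroot b) = 0) ->
    (forall a, P a) \/ (forall a, ~~ P a);
  coroot_span : forall lam, exists c : roots -> int, lam = \sum_a c a *: coroot a;
  simple_root_free : forall c : 'I_n -> int,
    \sum_i c i *: val (simple_root i) = 0 -> forall i, c i = 0;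
  simple_root_base : forall a : roots, exists c : 'I_n -> nat,
    val a = \sum_i (c i)%:Z *: val (simple_root i) \/
    val a = - \sum_i (c i)%:Z *: val (simple_root i);
  highest_rootP : forall a : roots, exists c : 'I_n -> nat,
    val highest_root = val a + \sum_i (c i)%:Z *: val (simple_root i) }.

Section AffineWeyl.
Variables (n : nat) (G : simple_sc_datum n).
Local Notation roots := (roots G).
Local Notation coroot := (@coroot n G).

Definition refl (a : roots) : 'M[int]_n := 1%:M - val a *m coroot a.

Lemma reflE a mu : refl a *m mu = mu - pairing mu (coroot a) *: val a.
Proof.
rewrite /refl mulmxBl mul1mx -mulmxA; congr (_ - _).
by rewrite [coroot a *m mu]mx11_scalar mul_mx_scalar.
Qed.

Lemma refl_invol a : refl a *m refl a = 1%:M.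
Proof.
rewrite {2}/refl mulmxBr mulmx1 mulmxA reflE pairing_root.
rewrite [2 *: _]scaler_nat mulr2n opprD addNKr mulNmx opprK /refl.
by rewrite subrK.
Qed.

Definition weyl (w : 'M[int]_n) : bool :=
  `[< exists l : seq roots, w = foldr (fun a v => refl a *m v) 1%:M l >].

Lemma weyl1 : weyl 1%:M. Proof. by apply/asboolP; exists [::]. Qed.

Lemma weyl_refl a : weyl (refl a).
Proof. by apply/asboolP; exists [:: a]; rewrite /= mulmx1. Qed.

Lemma weylM v w : weyl v -> weyl w -> weyl (v *m w).
Proof.
move=> /asboolP[l ->] /asboolP[k ->]; apply/asboolP; exists (l ++ k).
by elim: l => [|a l IHl] /=; rewrite ?mul1mx // -mulmxA IHl.
Qed.

Lemma weyl_inv w : weyl w -> exists2 v, weyl v & v *m w = 1%:M.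
Proof.
move=> /asboolP[l ->]; elim: l => [|a l [v wv vl]] /=.
  by exists 1%:M; [apply: weyl1|rewrite mul1mx].
exists (v *m refl a); first exact/weylM/weyl_refl.
by rewrite -mulmxA (mulmxA (refl a)) refl_invol mul1mx.
Qed.

Lemma weyl_unit w : weyl w -> w \in unitmx.
Proof. by move=> /weyl_inv[v _ /mulmx1_unit[]]. Qed.

Lemma weylV w : weyl w -> weyl (invmx w).
Proof.
move=> ww; have [v wv vw] := weyl_inv ww.
by rewrite -[invmx w]mul1mx -vw -mulmxA mulmxV ?mulmx1 // weyl_unit.
Qed.

Lemma weyl_root w (a : roots) : weyl w -> w *m val a \in roots.
Proof.
move=> /asboolP[l ->]; elim: l => [|b l IHl] /=.
  by rewrite mul1mx; apply: valP.
by rewrite -mulmxA reflE (refl_root b [` IHl]%fset).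
Qed.

(* W |x Q^vee; (lam, w) stands for t_lam w.  By coroot_span, lam ranges over all
   of Q^vee. *)
Record aff_weyl := AffWeyl {
  aff_val : 'rV[int]_n * 'M[int]_n;
  _ : weyl aff_val.2 }.
HB.instance Definition _ := [isSub for aff_val].
HB.instance Definition _ := [Choice of aff_weyl by <:].

Definition aff_trans (w : aff_weyl) : 'rV[int]_n := (aff_val w).1.
Definition aff_lin (w : aff_weyl) : 'M[int]_n := (aff_val w).2.

Lemma aff_linP w : weyl (aff_lin w). Proof. exact: (valP w). Qed.

Lemma aff_weyl_eq v w :
  aff_trans v = aff_trans w -> aff_lin v = aff_lin w -> v = w.
Proof.
move: v w => [[l v] hv] [[m w] hw]; rewrite /aff_trans /aff_lin /= => e1 e2.
by apply: val_inj; rewrite /= e1 e2.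
Qed.

Definition mk_aff l w (hw : weyl w) : aff_weyl := @AffWeyl (l, w) hw.

Definition aff_one := mk_aff 0 weyl1.
(* t_lam v t_mu w = t_(lam + v mu) v w, where v acts on cocharacters by
   mu |-> mu v^-1, so that the pairing is W-invariant *)
Definition aff_mul v w :=
  mk_aff (aff_trans v + aff_trans w *m invmx (aff_lin v))
         (weylM (aff_linP v) (aff_linP w)).
Definition aff_inv w :=
  mk_aff (- (aff_trans w *m aff_lin w)) (weylV (aff_linP w)).

Fact aff_mulA : associative aff_mul.
Proof.
move=> u v w; apply: aff_weyl_eq; rewrite /aff_trans /aff_lin /= ?mulmxA //.
rewrite -!/(aff_trans _) -!/(aff_lin _) mulmxDl addrA; congr (_ + _).
rewrite -mulmxA; congr (_ *m _).
have [U V] := (weyl_unit (aff_linP u), weyl_unit (aff_linP v)).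
have UV : aff_lin u *m aff_lin v \in unitmx by rewrite unitmx_mul U.
by apply: (can_inj (mulKmx UV)); rewrite mulmxV // -mulmxA mulKVmx ?mulmxV // mulmxA.
Qed.
Fact aff_mul1 : left_id aff_one aff_mul.
Proof.
move=> w; apply: aff_weyl_eq; rewrite /aff_trans /aff_lin /= ?mul1mx //.
by rewrite invmx1 mulmx1 add0r.
Qed.
Fact aff_1mul : right_id aff_one aff_mul.
Proof.
move=> w; apply: aff_weyl_eq; rewrite /aff_trans /aff_lin /= ?mulmx1 //.
by rewrite mul0mx addr0.
Qed.
Fact aff_mulV : left_inverse aff_one aff_inv aff_mul.
Proof.
move=> w; have U := weyl_unit (aff_linP w).
apply: aff_weyl_eq; rewrite /aff_trans /aff_lin /= ?mulVmx //.
by rewrite invmxK addNr.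
Qed.
Fact aff_Vmul : right_inverse aff_one aff_inv aff_mul.
Proof.
move=> w; have U := weyl_unit (aff_linP w).
apply: aff_weyl_eq; rewrite /aff_trans /aff_lin /= ?mulmxV //.
by rewrite mulNmx mulmxK ?subrr.
Qed.
HB.instance Definition _ := isGroup.Build aff_weyl
  aff_mulA aff_mul1 aff_1mul aff_mulV aff_Vmul.

(* T_a^* = T^* (+) Z delta *)
Definition aff_chars := ('cV[int]_n * int)%type.
HB.instance Definition _ := GRing.Zmodule.on aff_chars.

(* t_lam nu = nu - <nu, lam> delta, which is the sign that makes aff_reflE hold *)
Definition aff_act (w : aff_weyl) (mu : aff_chars) : aff_chars :=
  let nu := aff_lin w *m mu.1 in (nu, mu.2 - pairing nu (aff_trans w)).

Fact aff_act_zmod w : zmod_morphism (aff_act w).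
Proof.
move=> mu nu; rewrite /aff_act; congr (_, _) => /=; first by rewrite mulmxBr.
by rewrite /pairing !mulmxBr !mxE; ring.
Qed.
HB.instance Definition _ w :=
  GRing.isZmodMorphism.Build aff_chars aff_chars (aff_act w) (aff_act_zmod w).

Lemma aff_actM v w mu : aff_act (v * w)%g mu = aff_act v (aff_act w mu).
Proof.
have U := weyl_unit (aff_linP v).
have E : aff_trans w *m invmx (aff_lin v) *m (aff_lin v *m (aff_lin w *m mu.1))
       = aff_trans w *m (aff_lin w *m mu.1).
  by rewrite -mulmxA; congr (_ *m _); rewrite mulKmx.
rewrite /aff_act; have -> : aff_lin (v * w)%g = aff_lin v *m aff_lin w by [].
rewrite -mulmxA; congr (_, _) => /=.
have -> : aff_trans (v * w)%g = aff_trans v + aff_trans w *m invmx (aff_lin v) by [].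
rewrite /pairing mulmxDl E mxE; ring.
Qed.

(* (a, k) stands for a + k delta *)
Definition aff_root := (roots * int)%type.
HB.instance Definition _ := Choice.on aff_root.

Definition aff_root_val (b : aff_root) : aff_chars := (val b.1, b.2).

Definition aff_root_act (w : aff_weyl) (b : aff_root) : aff_root :=
  ([` weyl_root b.1 (aff_linP w)]%fset, (aff_act w (aff_root_val b)).2).

Lemma aff_root_actE w b :
  aff_root_val (aff_root_act w b) = aff_act w (aff_root_val b).
Proof. by []. Qed.

Definition transl (lam : 'rV[int]_n) : aff_weyl := mk_aff lam weyl1.
Definition aff_refl (b : aff_root) : aff_weyl :=
  (mk_aff 0 (weyl_refl b.1) * transl (b.2 *: coroot b.1))%g.

Lemma aff_reflE b mu :
  aff_act (aff_refl b) mu = mu - aff_root_val b *~ pairing mu.1 (coroot b.1).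
Proof.
rewrite aff_actM /aff_act /aff_lin /aff_trans /= mul1mx reflE.
have mulzE (x : aff_chars) z : x *~ z = (z *: x.1, z * x.2).
  have mulnE k : x *+ k = (k%:Z *: x.1, k%:Z * x.2).
    elim: k => [|k IHk]; first by rewrite scale0r mul0r.
    by rewrite mulrS IHk -[k.+1]add1n PoszD scalerDl mulrDl scale1r mul1r.
  case: z => k; first exact: mulnE.
  by rewrite NegzE mulrNz -pmulrn mulnE scaleNr mulNr.
rewrite mulzE; congr (_, _) => /=; rewrite /pairing.
by rewrite -scalemxAl mul0mx !mxE subr0 mulrC.
Qed.

Lemma root_opp (a : roots) : - val a \in roots.
Proof.
have := refl_root a a; rewrite pairing_root.
by rewrite scaler_nat mulr2n opprD addNKr.
Qed.

Definition simple_aff_root (i : 'I_n.+1) : aff_root :=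
  if unlift ord0 i is Some j then (simple_root G j, 0)
  else ([` root_opp (highest_root G)]%fset, 1).

End AffineWeyl.

Section AffineHecke.
Variables (n : nat) (G : simple_sc_datum n) (R : comNzRingType) (F : fgl R).
Local Notation W := (aff_weyl G).

Definition Shat : comNzRingType := fga F (aff_chars n).
Definition xroot (b : aff_root G) : Shat := fga_x F (aff_root_val b).
Definition Qhat : comPzRingType := loc xroot.

Definition Shat_act (w : W) : Shat -> Shat := @fga_map R F _ (aff_act w).
HB.instance Definition _ w := GRing.RMorphism.copy (Shat_act w)
  (@fga_map R F _ (aff_act w)).
Definition Qhat_act (w : W) : Qhat -> Qhat :=
  loc_map (x := xroot) (Shat_act w) (aff_root_act w).

Fact Qhat_act_compat w b : Shat_act w (xroot b) = xroot (aff_root_act w b).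
Proof. exact: fga_mapX. Qed.
HB.instance Definition _ w := GRing.isZmodMorphism.Build Qhat Qhat (Qhat_act w)
  (loc_map_zmod (Qhat_act_compat w)).
HB.instance Definition _ w := GRing.isMonoidMorphism.Build Qhat Qhat (Qhat_act w)
  (loc_map_monoid (Qhat_act_compat w)).

Definition ofS (s : Shat) : Qhat := loc_inj xroot s.

Definition QW := {malg Qhat[W]}.
HB.instance Definition _ := GRing.Zmodule.on QW.

Definition QW_scale (c : Qhat) (y : QW) : QW := [malg w in msupp y => c * y@_w].

Lemma QW_scaleE c y w : (QW_scale c y)@_w = c * y@_w.
Proof. by rewrite mcoeffE; case: msuppP => // _; rewrite mulr0. Qed.

Fact QW_scaleA c d y : QW_scale c (QW_scale d y) = QW_scale (c * d) y.
Proof. by apply/malgP => w; rewrite !QW_scaleE mulrA. Qed.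
Fact QW_scale1 : left_id 1 QW_scale.
Proof. by move=> y; apply/malgP => w; rewrite QW_scaleE mul1r. Qed.
Fact QW_scaleDr : right_distributive QW_scale +%R.
Proof. by move=> c y z; apply/malgP => w; rewrite mcoeffD !QW_scaleE mcoeffD mulrDr. Qed.
Fact QW_scaleDl y : {morph QW_scale^~ y : c d / c + d}.
Proof. by move=> c d; apply/malgP => w; rewrite mcoeffD !QW_scaleE mulrDl. Qed.
HB.instance Definition _ := GRing.Zmodule_isLmodule.Build Qhat QW
  QW_scaleA QW_scale1 QW_scaleDr QW_scaleDl.

Definition eta (w : W) : QW := mkmalgU w 1.

(* The twisted product, see QW_mul_eta *)
Definition QW_mul (y z : QW) : QW :=
  \sum_(v <- msupp y) \sum_(w <- msupp z)
    (y@_v * Qhat_act v z@_w) *: eta (v * w)%g.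

Lemma coefZeta a v w : (a *: eta v)@_w = a *+ (v == w).
Proof. by rewrite [LHS]QW_scaleE mcoeffU mulrnAr mulr1. Qed.

Lemma msuppZeta a v : (msupp (a *: eta v) `<=` [fset v])%fset.
Proof.
apply/fsubsetP => w; rewrite -mcoeff_neq0 coefZeta in_fset1.
by case: (eqVneq v w) => [_|_]; rewrite ?mulr0n ?eqxx.
Qed.

Lemma QW_mul_eta a v b w :
  QW_mul (a *: eta v) (b *: eta w) = (a * Qhat_act v b) *: eta (v * w)%g.
Proof.
rewrite /QW_mul (big_fset_incl _ (msuppZeta a v)); last first.
  move=> u _ /mcoeff_outdom ->; rewrite big1 // => t _.
  by rewrite mul0r scale0r.
rewrite big_seq_fset1 (big_fset_incl _ (msuppZeta b w)); last first.
  by move=> u _ /mcoeff_outdom ->; rewrite rmorph0 mulr0 scale0r.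
by rewrite big_seq_fset1 !coefZeta !eqxx !mulr1n.
Qed.

Definition Xhat (i : 'I_n.+1) : QW :=
  let b := simple_aff_root G i in
  loc_inv xroot b *: (eta 1%g - eta (aff_refl b)).

Inductive Dhat : QW -> Prop :=
| Dhat_S s : Dhat (ofS s *: eta 1%g)
| Dhat_X i : Dhat (Xhat i)
| Dhat_add y z : Dhat y -> Dhat z -> Dhat (y + z)
| Dhat_mul y z : Dhat y -> Dhat z -> Dhat (QW_mul y z).

(* Shat is identified with its image in Qhat. *)
Definition in_Shat (q : Qhat) : Prop := exists s, q = ofS s.

(* f is the Qhat-linear extension of a Shat-linear map g from Dhat to Shat; only
   the restriction of g to Dhat matters. *)
Definition Dhat_dual (f : {scalar QW}) : Prop :=
  exists g : QW -> Qhat,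
  [/\ forall d, Dhat d -> in_Shat (g d),
      forall s d d', Dhat d -> Dhat d' -> g (ofS s *: d + d') = ofS s * g d + g d'
    & forall d, Dhat d -> f d = g d].

Definition lin_ext (h : W -> Qhat) (y : QW) : Qhat :=
  \sum_(w <- msupp y) y@_w * h w.

Lemma lin_extEw (D : {fset W}) h y : (msupp y `<=` D)%fset ->
  lin_ext h y = \sum_(w <- D) y@_w * h w.
Proof.
move=> sub; apply: (big_fset_incl _ sub) => w _ /mcoeff_outdom ->.
by rewrite mul0r.
Qed.

Fact lin_ext_scalar h : scalar (lin_ext h).
Proof.
move=> c y z; pose D := (msupp y `|` (msupp z `|` msupp (c *: y + z)))%fset.
rewrite (@lin_extEw D _ y) ?fsubsetUl // (@lin_extEw D _ z); last first.
  exact: fsubset_trans (fsubsetUl _ _) (fsubsetUr _ _).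
rewrite (@lin_extEw D); last first.
  exact: fsubset_trans (fsubsetUr _ _) (fsubsetUr _ _).
rewrite mulr_sumr -big_split; apply: eq_bigr => w _ /=.
by rewrite mcoeffD [(c *: y)@_w]QW_scaleE mulrDl mulrA.
Qed.
HB.instance Definition _ h := GRing.isLinear.Build Qhat QW Qhat *%R (lin_ext h) (lin_ext_scalar h).

Lemma lin_ext_eta h w : lin_ext h (eta w) = h w.
Proof.
by rewrite (lin_extEw h (msuppU_le)) big_seq_fset1 mcoeffUU mul1r.
Qed.

(* The left Hecke action z (.) f on the dual, see hecke_eta *)
Definition hecke (z : QW) (f : {scalar QW}) : {scalar QW} :=
  lin_ext (fun w => \sum_(v <- msupp z) z@_v * Qhat_act v (f (eta (v^-1 * w)%g))).

Lemma hecke_eta a v (f : {scalar QW}) w :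
  hecke (a *: eta v) f (eta w) = a * Qhat_act v (f (eta (v^-1 * w)%g)).
Proof.
rewrite [LHS]lin_ext_eta (big_fset_incl _ (msuppZeta a v)); last first.
  by move=> u _ /mcoeff_outdom ->; rewrite mul0r.
by rewrite big_seq_fset1 coefZeta eqxx mulr1n.
Qed.

End AffineHecke.

(* Main.v *)
Require Import Defs.
From HB Require Import structures.
From mathcomp Require Import all_boot all_order all_algebra.
From mathcomp Require Import finmap monalg boolp.
From mathcomp Require Import ring.

Set Implicit Arguments.
Unset Strict Implicit.
Unset Printing Implicit Defensive.

Import GRing.Theory.
Local Open Scope ring_scope.

(* Writing s for the reflection in an affine root a, one computes
     X_a (.) f (d) = (f(d) - s(f(eta_s d))) / x_a,   eta_s d = d - x_a X_a d,
   so that, with p = f(d) and q = f(X_a d), both in S,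
     X_a (.) f (d) = (p - s(p)) / x_a + (x_(-a) / x_a) s(q).
   It remains to see that x_a divides x_(-a) and p - s(p) in S.  The formal group
   law gives x_(a + mu) - x_mu in x_a S, hence x_mu - x_(s mu) in x_a S for all mu.
   This propagates to monomials by the twisted Leibniz rule, and a monomial of
   degree d has a quotient of order at least d - 1, so that the quotients of the
   homogeneous components of a power series can be summed. *)

(** * Monomials and the renaming of variables in polynomials *)

Section Monomials.
Variables (R : comNzRingType) (I : choiceType).
Local Notation P := {malg R[{cmonom I}]}.

(** Induction on the degree: a monomial other than 1 is a variable times a monomial of smaller
    degree. *)
Lemma cmonom_ind (Q : {cmonom I} -> Prop) :
  Q mone -> (forall i m, Q m -> Q (mmul (ucm i) m)) -> forall m, Q m.
Proof.
move=> Q1 QM m; have [d] := ubnP (mdeg m); elim: d m => // d IHd m led.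
have [/eqP m0|] := boolP (finsupp m == fset0).
  by rewrite (_ : m = mone) //; apply: mdeg_eq0I; rewrite mdegE m0 big_seq_fset0.
case/fset0Pn => i; rewrite -cmE_neq0 -lt0n => mi.
have E : m = mmul (ucm i) (divcm m (ucm i)).
  apply/eqP/cmP => j; rewrite cmM divcmE cmU.
  by case: (eqVneq i j) => [<-|_]; rewrite ?subnKC // add0n subn0.
rewrite E; apply/QM/IHd; move: led.
by rewrite {1}E mdegM mdegU add1n ltnS.
Qed.

Lemma malgUM (m1 m2 : {cmonom I}) : << mmul m1 m2 >> = << m1 >> * << m2 >> :> P.
Proof. by rewrite malgM_def fgmulUU mulr1. Qed.

Lemma monom_ren1 (g : I -> I) : monom_ren R g mone = 1.
Proof. exact: mmorph1. Qed.

Lemma monom_renM (g : I -> I) m1 m2 :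
  monom_ren R g (mmul m1 m2) = monom_ren R g m1 * monom_ren R g m2.
Proof. exact: mmorphM. Qed.

Lemma pol_renU (g : I -> I) m : pol_ren g << m >> = monom_ren R g m.
Proof. by rewrite /pol_ren mmapU mul1r. Qed.

Lemma monom_renU (g : I -> I) i : monom_ren R g (ucm i) = << ucm (g i) >>.
Proof. by rewrite /monom_ren mdomU big_seq_fset1 cmUU expr1. Qed.

Lemma malg_scaleE (p : P) : p = \sum_(m <- msupp p) p@_m *: << m >>.
Proof.
rewrite [LHS]monalgE; apply: eq_bigr => m _; apply/malgP => k.
move: (p@_m) => c.
by rewrite [RHS]mcoeffZ [LHS]mcoeffU [X in _ = _ * X]mcoeffU mulrnAr mulr1.
Qed.

Lemma pol_ren_sum (g : I -> I) (J : Type) (r : seq J) (f : J -> P) :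
  pol_ren g (\sum_(j <- r) f j) = \sum_(j <- r) pol_ren g (f j).
Proof. exact: rmorph_sum. Qed.

(** Both sides are linear and multiplicative in p, so agreement on the variables is enough. Through
    this, W_a acts on [Shat] and then on [Qhat]. *)
Lemma pol_ren_comp (g h : I -> I) (p : P) :
  pol_ren h (pol_ren g p) = pol_ren (h \o g) p.
Proof.
rewrite (malg_scaleE p) (pol_ren_sum g) (pol_ren_sum h) (pol_ren_sum (h \o g)).
apply: eq_bigr => m _.
rewrite !pol_renZ !pol_renU; congr (_ *: _).
elim/cmonom_ind: m => [|i m IHm]; first by rewrite !monom_ren1 rmorph1.
by rewrite !monom_renM rmorphM /= IHm !monom_renU pol_renU monom_renU.
Qed.

Lemma pol_ren_id (p : P) : pol_ren id p = p.
Proof.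
rewrite [RHS]malg_scaleE [in LHS](malg_scaleE p) pol_ren_sum.
apply: eq_bigr => m _; rewrite pol_renZ pol_renU; congr (_ *: _).
elim/cmonom_ind: m => [|i m IHm]; first exact: monom_ren1.
by rewrite monom_renM IHm monom_renU malgUM.
Qed.

End Monomials.

(** * Functoriality of the formal group algebra *)

Section RenamingAction.
Variables (R : comNzRingType) (F : fgl R) (M : zmodType).

Lemma fga_map_id (g : {additive M -> M}) : g =1 id -> @fga_map R F M g =1 id.
Proof.
move=> /funext gid p; have [{}p ->] := fga_piP p; rewrite fga_map_pi.
by congr fga_pi; apply: val_inj; apply: fps_eqP => d; rewrite /= gid pol_ren_id.
Qed.

Lemma fga_map_comp (g h k : {additive M -> M}) : k =1 h \o g ->
  forall p, @fga_map R F M k p = fga_map h (fga_map g p).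
Proof.
move=> /funext khg p; have [{}p ->] := fga_piP p; rewrite !fga_map_pi.
by congr fga_pi; apply: val_inj; apply: fps_eqP => d; rewrite /= khg pol_ren_comp.
Qed.

End RenamingAction.

(** * Order of vanishing and homogeneous components of power series *)

Section Order.
Variables (R : comNzRingType) (I : choiceType).
Local Notation fps := (fps R I).

(** The series of order at least [k], i.e. the filtration that defines the topology. *)
Definition vanish_below (k : nat) (p : fps) := forall d, (d < k)%N -> p d = 0.

Lemma fpsDE (p q : fps) d : (p + q) d = p d + q d. Proof. by []. Qed.

Lemma vanish_belowD k p q :
  vanish_below k p -> vanish_below k q -> vanish_below k (p + q).
Proof. by move=> hp hq d ltd; rewrite fpsDE hp ?hq ?addr0. Qed.

Lemma vanish_belowM k l p q :
  vanish_below k p -> vanish_below l q -> vanish_below (k + l) (p * q).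
Proof.
move=> hp hq d ltd; rewrite fpsME big1 // => i _.
have [lik|leki] := ltnP i k; first by rewrite hp ?mul0r.
rewrite hq ?mulr0 // ltn_subLR; last by rewrite -ltnS.
by rewrite (leq_trans ltd) // leq_add2r.
Qed.

Lemma vanish_belowMl k p q : vanish_below k q -> vanish_below k (p * q).
Proof. by move=> hq; rewrite -[k]add0n; apply: vanish_belowM. Qed.

Lemma vanish_belowX i : vanish_below 1 (fpsX R i).
Proof. by case. Qed.

Lemma vanish_below_sum (J : eqType) (r : seq J) (f : J -> fps) k :
  (forall j, j \in r -> vanish_below k (f j)) -> vanish_below k (\sum_(j <- r) f j).
Proof.
by move=> hf d ltd; rewrite fps_sumE big_seq big1 // => j /hf ->.
Qed.

Lemma fpsXM i (p : fps) d :
  (fpsX R i * p) d = if d is e.+1 then << ucm i >> * p e else 0.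
Proof.
rewrite fpsME; case: d => [|d]; first by rewrite big_ord1 mul0r.
rewrite big_ord_recl mul0r add0r big_ord_recl /= subSS subn0 big1 ?addr0 // => j _.
by rewrite mul0r.
Qed.

Lemma fps_ren_vanish (g : I -> I) k p : vanish_below k p -> vanish_below k (fps_ren g p).
Proof. by move=> hp d ltd; rewrite fps_renE hp ?rmorph0. Qed.

Fact fps_monom_subproof (m : {cmonom I}) d :
  homog d (if d == mdeg m then << m >> else 0 : {malg R[{cmonom I}]}).
Proof.
case: eqP => [->|_]; last exact: homog0.
by apply/homogP => k; rewrite msuppU1 in_fset1 => /eqP ->.
Qed.
Definition fps_monom m := Fps (fps_monom_subproof m).

Lemma fps_monom1 : fps_monom mone = 1.
Proof. by apply: fps_eqP => d; rewrite /= mdeg1. Qed.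

Lemma fps_monomM i m : fps_monom (mmul (ucm i) m) = fpsX R i * fps_monom m.
Proof.
apply: fps_eqP => d; rewrite fpsXM /= mdegM mdegU add1n malgUM.
by case: d => // d; rewrite eqSS; case: eqP => // _; rewrite mulr0.
Qed.

Fact fps_const_subproof (c : R) d :
  homog d (if d == 0%N then malgC c else 0 : {malg R[{cmonom I}]}).
Proof.
case: eqP => [->|_]; last exact: homog0.
apply/homogP => m /(fsubsetP (msuppC_le _)).
by rewrite in_fset1 => /eqP ->; rewrite mdeg1.
Qed.
Definition fps_const c := Fps (fps_const_subproof c).

Lemma fps_constM c (p : fps) d : (fps_const c * p) d = c *: p d.
Proof.
rewrite fpsME big_ord_recl /= subn0 mul_malgC big1 ?addr0 // => j _.
by rewrite mul0r.
Qed.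

Lemma fps_ren_const (g : I -> I) c : fps_ren g (fps_const c) = fps_const c.
Proof.
apply: fps_eqP => d; rewrite fps_renE /=; case: eqP => _; last exact: rmorph0.
by rewrite /pol_ren mmapC.
Qed.

Fact fps_component_subproof (p : fps) e d :
  homog d (if d == e then p e else 0).
Proof. by case: eqP => [->|_]; [exact: hcompP|exact: homog0]. Qed.
Definition fps_component p e := Fps (fps_component_subproof p e).

Lemma fps_componentE p e :
  fps_component p e = \sum_(m <- msupp (p e)) fps_const (p e)@_m * fps_monom m.
Proof.
apply: fps_eqP => d; rewrite fps_sumE big_seq.
under eq_bigr => m /(homogP _ _ (hcompP p e)) me do rewrite fps_constM /= me.
rewrite -big_seq /=; case: eqP => _; first exact: malg_scaleE.
by rewrite big1 // => m _; rewrite scaler0.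
Qed.

Lemma fps_sum_components (p : fps) N d :
  (\sum_(e < N) fps_component p e) d = if (d < N)%N then p d else 0.
Proof.
rewrite fps_sumE /=; case: ltnP => [ltd|leNd].
  rewrite (bigD1 (Ordinal ltd)) //= eqxx big1 ?addr0 // => e.
  by rewrite eq_sym -val_eqE /= => /negPf ->.
by rewrite big1 // => e _; rewrite gtn_eqF // (leq_trans (ltn_ord e)).
Qed.

End Order.

(** * Divisibility of differences in the formal group algebra *)

Section FgaDifferences.
Variables (R : comNzRingType) (F : fgl R) (M : zmodType).
Local Notation fps := (fps R M).
Local Notation amb := (fga_amb F M).
Local Notation S := (fga F M).
Local Notation x := (fga_x F).

Fact fga_xx0 : x 0 = 0 :> S.
Proof.
rewrite -[0 in RHS](rmorph0 (@fga_pi R F M)); apply/fga_pi_eq.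
have h : @fga_span R F M (FgaAmb (fga_x_subproof F 0) - 0).
  exists [:: (1, FgaAmb (fga_x_subproof F 0))]; split.
    by move=> y; rewrite inE => /eqP ->; left.
  by rewrite big_seq1 mul1r subr0.
by rewrite /fga_ideal_prop; case: ifP => // _ N; exists (FgaAmb (fga_x_subproof F 0) - 0).
Qed.

(* F(p, q) = q + p * fgl_quot p q when p and q have no constant term. *)
Fact fgl_quot_subproof (p q : fps) d :
  homog d (\sum_(i < d.+1) \sum_(j < d.+2) F i.+1 j *: (p ^+ i * q ^+ j) d).
Proof.
by apply: homog_sum => i _; apply: homog_sum => j _; apply: homogZ; apply: hcompP.
Qed.
Definition fgl_quot p q := Fps (fgl_quot_subproof p q).

(** The terms of F(p, q) with i = 0 add up to F(0, q) = q, and all the others contain a factor p. *)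
Lemma fgl_quotE mu nu : let p := fpsX R mu in let q := fpsX R nu in
  fps_eval2 F p q = q + p * fgl_quot p q.
Proof.
move=> p q; apply: fps_eqP => d.
have F0 j : F 0%N j = (j == 1%N)%:R by case: F.
rewrite fps_eval2E fpsDE big_ord_recl; congr (_ + _).
  under eq_bigr => j _ do rewrite F0 expr0 mul1r.
  case: d => [|d]; first by rewrite big_ord1 scale0r.
  rewrite big_ord_recl scale0r add0r big_ord_recl scale1r expr1 big1 ?addr0 // => j _.
  by rewrite scale0r.
(* In degree [d.+1] the left side runs over i, j <= d + 1. Without i = 0, and with i shifted by one,
   these are exactly the ranges of [fgl_quot] in degree [d], so the sums agree term by term. *)
rewrite fpsXM; case: d => [|d]; first by rewrite big_ord0.
rewrite mulr_sumr; apply: eq_bigr => i _; rewrite mulr_sumr; apply: eq_bigr => j _.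
by rewrite -scalerAr; congr (_ *: _); rewrite exprS -mulrA fpsXM.
Qed.

(** If F(x, y) = x + y - c x y, the quotient is 1 - c y, which has no component of degree 2 or
    more. *)
Fact fgl_quot_pred mu nu : fga_pred F (fgl_quot (fpsX R mu) (fpsX R nu)).
Proof.
apply/asboolP => -[c Fc]; exists 2%N => -[|[|d]] // _.
apply: big1 => i _; apply: big1 => j _; rewrite Fc !xpair_eqE !eqSS.
case: (i : nat) => [|i']; last by rewrite !mulr0n mulr0 subr0 addr0 scale0r.
case: (j : nat) => [|[|j']]; last by rewrite !mulr0n mulr0 subr0 addr0 scale0r.
  by rewrite expr0 mul1r /= scaler0.
by rewrite expr0 mul1r /= scaler0.
Qed.

(** Modulo the ideal, x_(mu + nu) is F(x_mu, x_nu), to which [fgl_quotE] applies. *)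
Lemma fga_xD mu nu : exists c : S, x (mu + nu) - x nu = x mu * c.
Proof.
exists (fga_pi (FgaAmb (fgl_quot_pred mu nu))).
rewrite /fga_x -rmorphB -rmorphM; apply/fga_pi_eq.
set p := (X in fga_ideal_prop X).
have h : fga_span p.
  exists [:: (1, p)]; split; last by rewrite big_seq1 mul1r.
  move=> y; rewrite inE => /eqP -> /=; right; exists mu, nu.
  by rewrite fgl_quotE opprD addrA.
by rewrite /fga_ideal_prop; case: ifP => // _ N; exists p.
Qed.

Lemma fga_x_mulz mu nu (k : int) : exists c : S, x (mu *~ k + nu) - x nu = x mu * c.
Proof.
have pos n nu' : exists c : S, x (mu *+ n + nu') - x nu' = x mu * c.
  elim: n nu' => [|n IHn] nu'; first by exists 0; rewrite mulr0n add0r subrr mulr0.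
  have [[c cE] [c' c'E]] := (IHn nu', fga_xD mu (mu *+ n + nu')).
  by exists (c + c'); rewrite mulrDr -cE -c'E mulrS -(addrA mu); ring.
case: k => n; first exact: pos.
(* A negative multiple is reached from the positive case by moving the base point to nu - (n + 1)
   mu; the difference then changes sign. *)
have [c cE] := pos n.+1 (- (mu *+ n.+1) + nu).
exists (- c); rewrite mulrN -cE opprB NegzE mulrNz -pmulrn.
by rewrite addrA subrr add0r.
Qed.

Lemma fga_x_opp mu : exists c : S, x (- mu) = x mu * c.
Proof.
have [c] := fga_x_mulz mu 0 (-1); rewrite mulrN1z addr0 fga_xx0 subr0.
by exists c.
Qed.

Section Endomorphism.
Variables (g : {additive M -> M}) (a : M).
(** The model is the reflection in a, for which the integer is the pairing of mu with the coroot of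
    a. *)
Hypothesis g_shift : forall mu, exists k : int, mu = a *~ k + g mu.
Local Notation gS := (@fga_map R F M g).

Let x_div mu : exists c : S, x mu - x (g mu) = x a * c.
Proof. by have [k {1}->] := g_shift mu; apply: fga_x_mulz. Qed.

Fact fps_monom_pred m : fga_pred F (@fps_monom R M m).
Proof.
apply/asboolP => _; exists (mdeg m).+1 => d ltd /=.
by rewrite gtn_eqF.
Qed.
Fact fps_const_pred c : fga_pred F (@fps_const R M c).
Proof. by apply/asboolP => _; exists 1%N => -[|d]. Qed.
Fact fps_component_pred (p : fps) e : fga_pred F (fps_component p e).
Proof.
apply/asboolP => _; exists e.+1 => d ltd /=.
by rewrite gtn_eqF.
Qed.
Local Notation monom m := (FgaAmb (fps_monom_pred m)).
Local Notation const c := (FgaAmb (fps_const_pred c)).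
Local Notation component p e := (FgaAmb (fps_component_pred p e)).

Let pi_monomM i m :
  fga_pi (monom (mmul (ucm i) m)) = x i * fga_pi (monom m) :> S.
Proof.
by rewrite -rmorphM; congr fga_pi; apply: val_inj; rewrite /= fps_monomM.
Qed.

(** Induction by the twisted Leibniz rule x_i m - g(x_i m) = x_i (m - g(m)) + (x_i - g(x_i)) g(m).
    The bound on the order is carried along because the convergence of the sum of quotients in
    [fga_map_div] depends on it. *)
Lemma monom_div m : exists2 c : amb, vanish_below (mdeg m).-1 (val c) &
  fga_pi (monom m) - gS (fga_pi (monom m)) = x a * fga_pi c.
Proof.
elim/cmonom_ind: m => [|i m [c hc cE]].
  exists 0 => //; have -> : fga_pi (monom mone) = 1 :> S.
    by rewrite -(rmorph1 (@fga_pi R F M)); congr fga_pi; apply: val_inj; rewrite /= fps_monom1.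
  by rewrite rmorph1 rmorph0 mulr0 subrr.
have [c0 c0E] := x_div i; have [c' c'E] := fga_piP c0.
exists (FgaAmb (fga_x_subproof F i) * c + c' * amb_ren g (monom m)).
  rewrite mdegM mdegU add1n /=; apply: vanish_belowD.
    (* For m of degree 0 the truncated predecessor is 0 and the required bound is void. *)
    case: (mdeg m) hc => // k hc; rewrite -add1n.
    by apply: vanish_belowM hc; apply: vanish_belowX.
  apply: vanish_belowMl; apply: fps_ren_vanish => d ltd /=.
  by rewrite ltn_eqF.
rewrite pi_monomM rmorphM /= fga_mapX rmorphD !rmorphM /= -/(fga_x F i) -fga_map_pi.
rewrite -c'E mulrDr mulrCA -cE mulrA -c0E.
by ring.
Qed.

(** A component is a finite combination of monomials of degree [e] with coefficients in R, which g
    fixes; the quotients of the monomials are combined with the same coefficients. *)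
Lemma component_div (p : fps) e : exists2 c : amb, vanish_below e.-1 (val c) &
  fga_pi (component p e) - gS (fga_pi (component p e)) = x a * fga_pi c.
Proof.
have [c hc cE] : exists2 c : {cmonom M} -> amb,
    forall m, vanish_below (mdeg m).-1 (val (c m)) &
    forall m, fga_pi (monom m) - gS (fga_pi (monom m)) = x a * fga_pi (c m).
  have [c hc] := choice (fun m => let: ex_intro2 c h1 h2 := monom_div m in
                          ex_intro (fun c => _ /\ _) c (conj h1 h2)).
  by exists c => m; case: (hc m).
exists (\sum_(m <- msupp (p e)) const (p e)@_m * c m).
  rewrite (raddf_sum val); apply: vanish_below_sum => m /(homogP _ _ (hcompP p e)) <-.
  exact/vanish_belowMl/hc.
have -> : component p e = \sum_(m <- msupp (p e)) const (p e)@_m * monom m.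
  by apply: val_inj; rewrite (raddf_sum val) /= fps_componentE.
rewrite !rmorph_sum -sumrB mulr_sumr; apply: eq_bigr => m _.
rewrite !rmorphM /= mulrCA -cE mulrBr; congr (_ - _ * _).
by rewrite fga_map_pi; congr fga_pi; apply: val_inj; rewrite /= fps_ren_const.
Qed.

(** The quotients of the components are added: a finite sum in the polynomial version, a convergent
    one otherwise. *)
Lemma fga_map_div (p : S) : exists c : S, p - gS p = x a * c.
Proof.
have [{}p ->] := fga_piP p.
have [c hc cE] : exists2 c : nat -> amb,
    forall e, vanish_below e.-1 (val (c e)) &
    forall e, fga_pi (component (val p) e) - gS (fga_pi (component (val p) e))
              = x a * fga_pi (c e).
  have [c hc] := choice (fun e => let: ex_intro2 c h1 h2 := component_div (val p) e in
                          ex_intro (fun c => _ /\ _) c (conj h1 h2)).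
  by exists c => e; case: (hc e).
pose pN N : amb := \sum_(e < N) component (val p) e.
have sumE N : fga_pi (pN N) - gS (fga_pi (pN N)) = x a * fga_pi (\sum_(e < N) c e).
  by rewrite !rmorph_sum -sumrB mulr_sumr; apply: eq_bigr => e _; exact: cE.
have pNE N d : val (pN N) d = if (d < N)%N then val p d else 0.
  by rewrite -fps_sum_components /pN (raddf_sum val).
have [polF|npolF] := asboolP (fgl_polynomial F).
  have [N hN] : fps_pol (val p) by case: (p) => q qP; apply: (asboolP _ qP).
  suff -> : p = pN N by exists (fga_pi (\sum_(e < N) c e)).
  apply: val_inj; apply: fps_eqP => d; rewrite pNE.
  by case: ltnP => // /hN.
(* c e vanishes below degree e - 1, so that this is the sum of all the c e. *)
have csub d : homog d (\sum_(e < d.+2) val (c e) d).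
  by apply: homog_sum => e _; apply: hcompP.
have cpred : fga_pred F (Fps csub) by apply/asboolP.
exists (fga_pi (FgaAmb cpred)).
rewrite fga_map_pi /fga_x -rmorphB -rmorphM; apply/fga_pi_eq.
(* Membership in the closure is tested below each degree N. There p may be replaced by its
   truncation [pN N], so an element of the ideal that approximates the relation [sumE N] below N
   also serves for p. *)
rewrite /fga_ideal_prop (asboolF npolF) => N.
have := sumE N; rewrite fga_map_pi /fga_x -rmorphB -rmorphM => /fga_pi_eq.
rewrite /fga_ideal_prop (asboolF npolF).
case/(_ N) => q sq eq.
exists q; first exact: sq.
move=> d ltd.
apply: etrans (eq d ltd).
have valE (r c' : amb) : val (r - amb_ren g r - FgaAmb (fga_x_subproof F a) * c') d
    = val r d - pol_ren g (val r d) - (fpsX R a * val c') d by [].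
apply: etrans (valE _ _) (etrans _ (esym (valE _ _))).
rewrite {valE} [in RHS](pNE N d) ltd.
apply: (congr1 (fun t => _ - t)).
apply: etrans (fpsXM _ _ _) (etrans _ (esym (fpsXM _ _ _))).
(* In degree [d.+1] < N only degree [d] of the two quotients matters. They differ by the [c e] with
   d + 2 <= e < N, which vanish in that degree because e - 1 > d. *)
case: d ltd => [|d] ltd; first by [].
apply: (congr1 (fun t => _ * t)).
rewrite (raddf_sum val) fps_sumE /=.
rewrite -(big_mkord xpredT (fun e => val (c e) d)).
rewrite -[in RHS](big_mkord xpredT (fun e => val (c e) d)).
rewrite [RHS](big_cat_nat _ ltd) //= [X in _ + X]big_nat_cond [X in _ + X]big1 ?addr0 // => e.
rewrite andbT => /andP[lede _]; apply: hc.
by case: e lede.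
Qed.

End Endomorphism.
End FgaDifferences.

(** * The canonical map to the localization *)

Section LocalizationMorphism.
Variables (S : comNzRingType) (J : choiceType) (x : J -> S).

Lemma loc_injD s t : loc_inj x (s + t) = loc_inj x s + loc_inj x t.
Proof.
by rewrite [RHS]loc_addE /loc_inj /den big_nil !mulr1.
Qed.

Lemma loc_injM s t : loc_inj x (s * t) = loc_inj x s * loc_inj x t.
Proof. by rewrite [RHS]loc_mulE. Qed.

End LocalizationMorphism.

(** * The affine Weyl group action and affine reflections *)

Section AffineAction.
Variables (n : nat) (G : simple_sc_datum n).

Lemma aff_act1 (mu : aff_chars n) : aff_act (1%g : aff_weyl G) mu = mu.
Proof.
case: mu => mu k; rewrite /aff_act /aff_lin /aff_trans /= mul1mx /pairing.
by rewrite mul0mx mxE subr0.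
Qed.

Lemma aff_root_val_inj : injective (@aff_root_val n G).
Proof. by move=> [a k] [b l] [/val_inj -> ->]. Qed.

Lemma aff_root_act1 (b : aff_root G) : aff_root_act 1%g b = b.
Proof. by apply: aff_root_val_inj; rewrite aff_root_actE aff_act1. Qed.

Lemma aff_root_actM (v w : aff_weyl G) (b : aff_root G) :
  aff_root_act (v * w)%g b = aff_root_act v (aff_root_act w b).
Proof. by apply: aff_root_val_inj; rewrite !aff_root_actE aff_actM. Qed.

(** Since s_a acts on cocharacters by right multiplication with its inverse, which is [refl a]
    itself, this is s_a(a^vee) = - a^vee; it comes from <a, a^vee> = 2. *)
Lemma coroot_refl (a : Defs.roots G) : coroot a *m refl a = - coroot a.
Proof.
rewrite /refl mulmxBr mulmx1 mulmxA [coroot a *m _]mx11_scalar.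
have := pairing_root a; rewrite /pairing => ->.
by rewrite mul_scalar_mx scaler_nat mulr2n opprD addNKr.
Qed.

(** For b = a + k delta the reflection is t_lam s_a with lam = - k a^vee. Its square has translation
    part lam + s_a(lam), which is 0 by [coroot_refl]. *)
Lemma aff_refl_sqr (b : aff_root G) : (aff_refl b * aff_refl b = 1)%g.
Proof.
set w := aff_refl b.
have invE : invmx (refl b.1) = refl b.1.
  rewrite -[invmx _]mulmx1 -(refl_invol b.1) mulKmx //.
  exact/weyl_unit/weyl_refl.
have tE : aff_trans w = - (b.2 *: coroot b.1).
  by rewrite [LHS]add0r invE -scalemxAl coroot_refl scalerN.
have lE : aff_lin w = refl b.1 by rewrite [LHS]mulmx1.
apply: aff_weyl_eq; last first.
  have -> : aff_lin (w * w)%g = aff_lin w *m aff_lin w by [].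
  by rewrite lE refl_invol.
have -> : aff_trans (w * w)%g = aff_trans w + aff_trans w *m invmx (aff_lin w) by [].
by rewrite tE lE invE mulNmx -scalemxAl coroot_refl scalerN opprK addNr.
Qed.

End AffineAction.

(** * The Hecke action and its integrality *)

Section Hecke.
Variables (n : nat) (G : simple_sc_datum n) (R : comNzRingType) (F : fgl R).
Local Notation W := (aff_weyl G).
Local Notation QW := (QW G F).
Local Notation Qhat := (Qhat G F).

Lemma Shat_act1 (p : Shat n F) : Shat_act (1%g : W) p = p.
Proof. exact/fga_map_id/aff_act1. Qed.

Lemma Shat_actM (v w : W) (p : Shat n F) :
  Shat_act (v * w)%g p = Shat_act v (Shat_act w p).
Proof. exact/fga_map_comp/aff_actM. Qed.

Lemma Shat_act_refl_div (b : aff_root G) (p : Shat n F) :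
  exists c, p - Shat_act (aff_refl b) p = xroot F b * c.
Proof.
apply: fga_map_div => mu; exists (pairing mu.1 (coroot b.1)).
by rewrite /= aff_reflE addrC subrK.
Qed.

(** The reflection in b sends b to -b, and x_b divides x_(-b). *)
Lemma Shat_act_refl_root (b : aff_root G) :
  exists c, Shat_act (aff_refl b) (xroot F b) = xroot F b * c.
Proof.
have [c cE] := fga_x_opp F (aff_root_val b); exists c.
rewrite [LHS]fga_mapX -cE; congr fga_x.
by rewrite /= aff_reflE pairing_root -pmulrn mulr2n opprD addNKr.
Qed.


Lemma Qhat_act_frac (w : W) s l :
  Qhat_act w (Defs.frac (xroot F) s l) =
  Defs.frac (xroot F) (Shat_act w s) (map (aff_root_act w) l).
Proof. exact: (loc_map_frac (@Qhat_act_compat n G R F w)). Qed.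

Lemma Qhat_act1 (q : Qhat) : Qhat_act 1%g q = q.
Proof.
have [s [l ->]] := Defs.fracP q.
by rewrite Qhat_act_frac Shat_act1 (eq_map (@aff_root_act1 n G)) map_id.
Qed.

Lemma Qhat_actM (v w : W) (q : Qhat) :
  Qhat_act (v * w)%g q = Qhat_act v (Qhat_act w q).
Proof.
have [s [l ->]] := Defs.fracP q.
by rewrite !Qhat_act_frac Shat_actM (eq_map (aff_root_actM v w)) map_comp.
Qed.

Lemma Qhat_act_ofS (w : W) (s : Shat n F) :
  Qhat_act w (ofS G s) = ofS G (Shat_act w s).
Proof. exact: Qhat_act_frac. Qed.

Lemma QW_sumE (y : QW) : y = \sum_(w <- msupp y) y@_w *: Defs.eta F w.
Proof.
rewrite [LHS]monalgE; apply: eq_bigr => w _; apply/malgP => u.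
by rewrite coefZeta mcoeffU.
Qed.

Lemma QW_scalarE (f : {scalar QW}) y :
  f y = \sum_(w <- msupp y) y@_w * f (Defs.eta F w).
Proof.
by rewrite {1}(QW_sumE y) linear_sum; apply: eq_bigr => w _; rewrite linearZ.
Qed.

Lemma QW_scalar_ext (f g : {scalar QW}) :
  (forall w, f (Defs.eta F w) = g (Defs.eta F w)) -> f =1 g.
Proof.
by move=> fg y; rewrite !QW_scalarE; apply: eq_bigr => w _; rewrite fg.
Qed.

Lemma scalar_QW_mul (f : {scalar QW}) y z :
  f (QW_mul y z) = \sum_(v <- msupp y) \sum_(w <- msupp z)
    (y@_v * Qhat_act v z@_w) * f (Defs.eta F (v * w)%g).
Proof.
rewrite linear_sum; apply: eq_bigr => v _; rewrite linear_sum.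
by apply: eq_bigr => w _; rewrite linearZ.
Qed.

Lemma QW_mul_etal (a : Qhat) (v : W) (z : QW) : QW_mul (a *: Defs.eta F v) z =
  \sum_(w <- msupp z) (a * Qhat_act v z@_w) *: Defs.eta F (v * w)%g.
Proof.
rewrite /QW_mul (big_fset_incl _ (msuppZeta a v)); last first.
  by move=> u _ /mcoeff_outdom ->; rewrite big1 // => w _; rewrite mul0r scale0r.
by rewrite big_seq_fset1 coefZeta eqxx mulr1n.
Qed.

Lemma heckeE z (f : {scalar QW}) w : hecke z f (Defs.eta F w) =
  \sum_(v <- msupp z) z@_v * Qhat_act v (f (Defs.eta F (v^-1 * w)%g)).
Proof. exact: lin_ext_eta. Qed.

(** At d = eta_w the value is the linear extension of v |-> v(f(eta_(v^-1 w))) evaluated at z, and a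
    general d is a combination of the eta_w. *)
Lemma hecke_linear (f : {scalar QW}) d : scalar (fun z => hecke z f d).
Proof.
move=> c y z; rewrite [LHS](QW_scalarE (hecke (c *: y + z) f)).
rewrite (QW_scalarE (hecke y f)) (QW_scalarE (hecke z f)) mulr_sumr -big_split /=.
apply: eq_bigr => w _; rewrite !heckeE.
have := lin_ext_scalar (fun v => Qhat_act v (f (Defs.eta F (v^-1 * w)%g))) c y z.
by rewrite /lin_ext => ->; rewrite mulrDr mulrCA.
Qed.

(** It is enough to evaluate at eta_w. There both sides expand into the same double sum, because (v
    u)^-1 w = u^-1 (v^-1 w). *)
Lemma heckeM y z (f : {scalar QW}) : hecke (QW_mul y z) f =1 hecke y (hecke z f).
Proof.
apply: QW_scalar_ext => w.
pose h v := Qhat_act v (f (Defs.eta F (v^-1 * w)%g)).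
transitivity (lin_ext h (QW_mul y z)); first exact: lin_ext_eta.
rewrite scalar_QW_mul [RHS]heckeE; apply: eq_bigr => v _.
rewrite heckeE rmorph_sum mulr_sumr; apply: eq_bigr => u _.
by rewrite /= lin_ext_eta /h Qhat_actM rmorphM -mulrA monoid.invgM mulgA.
Qed.

(** The formula known on the eta_w extends to all d: multiplication by eta_(v^-1) twists the
    coefficients of d by v^-1, and the outer v undoes this. The factor [1 *:] gives the product the
    shape used in [QW_mul_etal]. *)
Lemma hecke_eta_inv a v (f : {scalar QW}) d :
  hecke (a *: Defs.eta F v) f d = a * Qhat_act v (f (QW_mul (1 *: Defs.eta F v^-1%g) d)).
Proof.
rewrite QW_mul_etal linear_sum QW_scalarE rmorph_sum mulr_sumr.
apply: eq_bigr => w _; rewrite hecke_eta mul1r linearZ rmorphM /= -Qhat_actM mulgV Qhat_act1.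
by rewrite mulrCA.
Qed.

Lemma QW_mul_eta1 (a : Qhat) (d : QW) : QW_mul (a *: Defs.eta F 1%g) d = a *: d.
Proof.
rewrite QW_mul_etal [in RHS](QW_sumE d) scaler_sumr.
by apply: eq_bigr => w _; rewrite Qhat_act1 mul1g scalerA.
Qed.

Lemma QW_mulDl (y y' z : QW) : QW_mul (y + y') z = QW_mul y z + QW_mul y' z.
Proof.
pose t (y : QW) v := \sum_(w <- msupp z) (y@_v * Qhat_act v z@_w) *: Defs.eta F (v * w)%g.
pose D := (msupp y `|` (msupp y' `|` msupp (y + y')))%fset.
have mulE x : (msupp x `<=` D)%fset -> QW_mul x z = \sum_(v <- D) t x v.
  move=> sub; apply: (big_fset_incl _ sub) => v _ /mcoeff_outdom xv.
  by rewrite big1 // => w _; rewrite xv mul0r scale0r.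
have [subD suby suby'] : [/\ msupp (y + y') `<=` D, msupp y `<=` D & msupp y' `<=` D]%fset.
  by rewrite /D fsetUA fsubsetUr -fsetUA fsubsetUl fsetUCA fsubsetUl.
rewrite !mulE //.
rewrite -big_split; apply: eq_bigr => v _; rewrite -big_split /=.
by apply: eq_bigr => w _; rewrite mcoeffD mulrDl scalerDl.
Qed.

Lemma Xhat_mul i (d : QW) : let b := simple_aff_root G i in
  QW_mul (Xhat G F i) d =
  loc_inv (xroot F) b *: (d - QW_mul (1 *: Defs.eta F (aff_refl b)) d).
Proof.
move=> b; have -> : Xhat G F i = loc_inv (xroot F) b *: Defs.eta F 1%g
    + (- loc_inv (xroot F) b) *: Defs.eta F (aff_refl b).
  by rewrite scaleNr -scalerBr.
rewrite [LHS]QW_mulDl scalerBr -scaleNr.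
congr (_ + _); first exact: QW_mul_eta1.
rewrite !QW_mul_etal scaler_sumr; apply: eq_bigr => w _.
by rewrite mul1r scalerA.
Qed.

Lemma ofSD (s t : Shat n F) : ofS G (s + t) = ofS G s + ofS G t.
Proof. exact: loc_injD. Qed.

Lemma ofSM (s t : Shat n F) : ofS G (s * t) = ofS G s * ofS G t.
Proof. exact: loc_injM. Qed.

Lemma in_ShatD (p q : Qhat) : in_Shat p -> in_Shat q -> in_Shat (p + q).
Proof. by move=> [s ->] [t ->]; exists (s + t); rewrite /ofS loc_injD. Qed.

Lemma in_ShatM (p q : Qhat) : in_Shat p -> in_Shat q -> in_Shat (p * q).
Proof. by move=> [s ->] [t ->]; exists (s * t); rewrite /ofS loc_injM. Qed.

Lemma hecke_Xhat i (f : {scalar QW}) (d : QW) : let b := simple_aff_root G i in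
  hecke (Xhat G F i) f d = loc_inv (xroot F) b *
    (f d - Qhat_act (aff_refl b) (f (QW_mul (1 *: Defs.eta F (aff_refl b)) d))).
Proof.
(* The reflection term comes first so that the sum has the shape c y + z of [hecke_linear]. *)
move=> b; have -> : Xhat G F i = (- loc_inv (xroot F) b) *: Defs.eta F (aff_refl b)
    + loc_inv (xroot F) b *: Defs.eta F 1%g.
  by rewrite scaleNr addrC -scalerBr.
have sV : (aff_refl b)^-1%g = aff_refl b.
  by apply: (can_inj (mulgK (aff_refl b))); rewrite mulVg aff_refl_sqr.
rewrite (hecke_linear f d _ _ (_ *: Defs.eta F 1%g)) addrC mulrBr -mulNr.
congr (_ + _); first by rewrite hecke_eta_inv invg1 Qhat_act1 QW_mul_eta1 scale1r.
by congr (_ * _); rewrite -[X in hecke X]scale1r hecke_eta_inv mul1r sV.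
Qed.

Lemma hecke_Xhat_Dhat i (f : {scalar QW}) (d : QW) :
  (forall d, Dhat d -> in_Shat (f d)) -> Dhat d -> in_Shat (hecke (Xhat G F i) f d).
Proof.
move=> fS Dd; rewrite hecke_Xhat.
set b := simple_aff_root G i; set y := loc_inv _ b; set s := aff_refl b.
have DXd : Dhat (QW_mul (Xhat G F i) d) by apply: Dhat_mul => //; apply: Dhat_X.
have xy : ofS G (xroot F b) * y = 1 by apply: loc_invP.
(* This trades eta_s d, which need not lie in [Dhat], for d and X_b d, which do. *)
have -> : QW_mul (1 *: Defs.eta F s) d = (- ofS G (xroot F b)) *: QW_mul (Xhat G F i) d + d.
  by rewrite Xhat_mul scalerA mulNr xy scaleN1r opprB addrNK.
rewrite linearP.
have [[p fd] [q fXd]] := (fS _ Dd, fS _ DXd).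
rewrite fd fXd rmorphD rmorphM rmorphN /= !Qhat_act_ofS -/s.
have [c pc] := Shat_act_refl_div b p; have [u su] := Shat_act_refl_root b.
(* Here p - s(p) = x_b c and s(x_b) = x_b u. Since f(eta_s d) = p - x_b q, the difference to be
   divided by x_b is x_b (c + u s(q)). *)
exists (c + u * Shat_act s q).
have E : ofS G p = ofS G (Shat_act s p) + ofS G (xroot F b) * ofS G c.
  by rewrite -ofSM -ofSD -pc addrC subrK.
rewrite su E ofSD !ofSM.
transitivity ((ofS G (xroot F b) * y) * (ofS G c + ofS G u * ofS G (Shat_act s q))).
  by ring.
by rewrite xy mul1r.
Qed.

(** Induction on the generation of [Dhat]. The functional f stays general because a product y z acts
    as y on the functional z (.) f, to which the induction hypothesis for y must apply. *)
Lemma hecke_Dhat (z : QW) (f : {scalar QW}) (d : QW) : Dhat z ->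
  (forall d, Dhat d -> in_Shat (f d)) -> Dhat d -> in_Shat (hecke z f d).
Proof.
move=> Dz; elim: Dz f d => {z} [s|i|y z _ IHy _ IHz|y z _ IHy _ IHz] f d fS Dd.
- rewrite hecke_eta_inv invg1 Qhat_act1 QW_mul_eta1 scale1r.
  by apply: in_ShatM (fS _ Dd); exists s.
- exact: hecke_Xhat_Dhat.
- have := hecke_linear f d 1 y z; rewrite scale1r mul1r => ->.
  by apply: in_ShatD; [apply: IHy|apply: IHz].
- rewrite heckeM; apply: IHy => // e De; exact: IHz.
Qed.

End Hecke.

Theorem lemma2p7 (n : nat) (G : simple_sc_datum n)
  (R : idomainType) (charR0 : [pchar R] =i pred0) (F : fgl R)
  (z : QW G F) (f : {scalar QW G F}) :
  Dhat z -> Dhat_dual f -> Dhat_dual (hecke z f).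
Proof.
(* As [hecke z f] is already [Qhat]-linear, it serves as its own restriction to [Dhat], and only its
   integrality there is left; f is integral on [Dhat] because it agrees with g. *)
move=> Dz [g [gS _ fg]]; exists (hecke z f); split=> // [d Dd|s d d' _ _].
  by apply: hecke_Dhat => // e De; rewrite fg //; apply: gS.
exact: linearP.
Qed.
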